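(* Let $\mathbb{K}$ be a commutative ring with unit. Every cocommutative Hopf algebra over $\mathbb{K}$ is a protomodular object in the category $\mathsf{BiAlg}_{\mathbb{K},\mathit{coc}}$ of cocommutative bialgebras over $\mathbb{K}$.
   Context: $\mathsf{BiAlg}_{\mathbb{K},\mathit{coc}}$ is the category of cocommutative $\mathbb{K}$-bialgebras (associative, unital, coassociative, counital), with bialgebra morphisms (algebra and coalgebra maps preserving units and counits). It is a pointed category with finite limits, with zero object $\mathbb{K}$. A Hopf algebra is a bialgebra that admits an antipode. In a pointed category with finite limits: A split extension over $Y$ is a diagram consisting of morphisms $k\colon K\to X$, $f\colon X\to Y$, $s\colon Y\to X$ such that $k$ is a (categorical) kernel of $f$ and $f\circ s=1_Y$ (it is not required that $f$ be a cokernel of $k$). A pair of arrows $(k\colon K\to X,\ s\colon Y\to X)$ is jointly extremally epimorphic when, for every monomorphism $m\colon M\to X$ such that both $k$ and $s$ factor through $m$, the morphism $m$ is an isomorphism. A split extension $(k,f,s)$ is strong when $(k,s)$ is jointly extremally epimorphic. The pullback of a split extension $(k,f,s)$ over $Y$ along $g\colon W\to Y$ is the split extension over $W$ given by the pullback projection $\pi_1\colon W\times_Y X\to W$, its section $\langle 1_W, s\circ g\rangle$, and the kernel of $\pi_1$. A split extension over $Y$ is stably strong when all of its pullbacks along all morphisms $g\colon W\to Y$ are strong. An object $Y$ is protomodular when all split extensions over $Y$ are stably strong. *)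

(* Defs.v *)
From HB Require Import structures.
From mathcomp Require Import all_boot all_order all_algebra.
From mathcomp Require Import boolp.

Set Implicit Arguments.
Unset Strict Implicit.
Unset Printing Implicit Defensive.

Import GRing.Theory.
Local Open Scope ring_scope.
Local Open Scope quotient_scope.

(* Tensor product of modules over a commutative ring: formal finite sums of   *)
(* pairs (u, v), modulo the congruence generated by the bilinearity relations *)
(* (a multiple or the opposite of a pair is again a pair).                    *)
Section Tensor.
Variables (K : comPzRingType) (U V : lmodType K).
Implicit Types (s t : seq (U * V)) (a b : K) (u : U) (v : V).

Inductive tens_eq : seq (U * V) -> seq (U * V) -> Prop :=
| TensRefl s : tens_eq s s
| TensSym s t : tens_eq s t -> tens_eq t s
| TensTrans s t r : tens_eq s t -> tens_eq t r -> tens_eq s r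
| TensCat s s' t t' : tens_eq s s' -> tens_eq t t' -> tens_eq (s ++ t) (s' ++ t')
| TensCatC s t : tens_eq (s ++ t) (t ++ s)
| TensDl u u' v : tens_eq [:: (u + u', v)] [:: (u, v); (u', v)]
| TensDr u v v' : tens_eq [:: (u, v + v')] [:: (u, v); (u, v')]
| TensZ a u v : tens_eq [:: (a *: u, v)] [:: (u, a *: v)]
| Tens0 v : tens_eq [:: (0, v)] [::].

Definition tens_eqb s t := `[< tens_eq s t >].

Fact tens_eqb_refl : reflexive tens_eqb.
Proof. by move=> s; apply/asboolP/TensRefl. Qed.

Fact tens_eqb_sym : symmetric tens_eqb.
Proof. by move=> s t; apply/asboolP/asboolP; apply: TensSym. Qed.

Fact tens_eqb_trans : transitive tens_eqb.
Proof. by move=> s t r /asboolP st /asboolP sr; apply/asboolP/TensTrans/sr. Qed.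

Definition tens_rel : equiv_rel (seq (U * V)) :=
  EquivRel tens_eqb tens_eqb_refl tens_eqb_sym tens_eqb_trans.

Definition tens : Type := {eq_quot tens_rel}.
HB.instance Definition _ := Choice.on tens.

Definition tens_of s : tens := \pi s.
Definition tens_repr (x : tens) : seq (U * V) := repr x.

Lemma tens_reprK : cancel tens_repr tens_of.
Proof. by move=> x; apply: reprK. Qed.

Lemma tens_ofP s t : tens_of s = tens_of t <-> tens_eq s t.
Proof.
by split=> [/eqquotP/asboolP|st] //; apply/eqquotP/asboolP.
Qed.

Lemma tens_of_repr s : tens_eq (tens_repr (tens_of s)) s.
Proof. by apply/tens_ofP; rewrite tens_reprK. Qed.

Definition tens_scale_seq a s := [seq (a *: p.1, p.2) | p <- s].
Definition tens_zero : tens := tens_of [::].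
Definition tens_add (x y : tens) := tens_of (tens_repr x ++ tens_repr y).
Definition tens_scale a (x : tens) := tens_of (tens_scale_seq a (tens_repr x)).

Lemma tens_scale_seq_eq a s t :
  tens_eq s t -> tens_eq (tens_scale_seq a s) (tens_scale_seq a t).
Proof.
elim=> {s t} /=.
- by move=> s; apply: TensRefl.
- by move=> s t _; apply: TensSym.
- by move=> s t r _ + _; apply: TensTrans.
- by move=> s s' t t' _ es _ et; rewrite /tens_scale_seq !map_cat; apply: TensCat.
- by move=> s t; rewrite /tens_scale_seq !map_cat; apply: TensCatC.
- by move=> u u' v; rewrite scalerDr; apply: TensDl.
- by move=> u v v'; apply: TensDr.
- by move=> b u v; rewrite scalerA mulrC -scalerA; apply: TensZ.
- by move=> v; rewrite scaler0; apply: Tens0.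
Qed.

Lemma tens_addE s t : tens_add (tens_of s) (tens_of t) = tens_of (s ++ t).
Proof. by apply/tens_ofP/TensCat; apply: tens_of_repr. Qed.

Lemma tens_scaleE a s : tens_scale a (tens_of s) = tens_of (tens_scale_seq a s).
Proof. exact/tens_ofP/tens_scale_seq_eq/tens_of_repr. Qed.

Fact tens_addA : associative tens_add.
Proof.
move=> x y z; rewrite -[x]tens_reprK -[y]tens_reprK -[z]tens_reprK.
by rewrite !tens_addE catA.
Qed.

Fact tens_addC : commutative tens_add.
Proof. by move=> x y; apply/tens_ofP/TensCatC. Qed.

Fact tens_add0 : left_id tens_zero tens_add.
Proof. by move=> x; rewrite -[x]tens_reprK tens_addE. Qed.

Fact tens_scaleDl x a b :
  tens_scale (a + b) x = tens_add (tens_scale a x) (tens_scale b x).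
Proof.
rewrite -[x]tens_reprK !tens_scaleE tens_addE; apply/tens_ofP.
elim: (tens_repr x) => [|[u v] s IHs] /=; first exact: TensRefl.
rewrite scalerDl; apply: TensTrans (TensCat (TensDl _ _ _) IHs) _ => /=.
apply: (TensCat (TensRefl [:: _])); rewrite -cat_rcons -cats1.
exact: (TensCat (TensCatC [:: _] _) (TensRefl _)).
Qed.

Fact tens_scale0 x : tens_scale 0 x = tens_zero.
Proof.
rewrite -[x]tens_reprK tens_scaleE; apply/tens_ofP.
elim: (tens_repr x) => [|[u v] s IHs] /=; first exact: TensRefl.
by rewrite scale0r; apply: (TensCat (Tens0 v) IHs).
Qed.

Fact tens_scale1 : left_id 1 tens_scale.
Proof.
move=> x; rewrite -[x]tens_reprK tens_scaleE; congr tens_of.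
by elim: (tens_repr x) => [|[u v] s /= ->] //=; rewrite scale1r.
Qed.

Fact tens_scaleA a b x : tens_scale a (tens_scale b x) = tens_scale (a * b) x.
Proof.
rewrite -[x]tens_reprK !tens_scaleE; congr tens_of.
by elim: (tens_repr x) => [|[u v] s /= ->] //=; rewrite scalerA.
Qed.

Fact tens_scaleDr : right_distributive tens_scale tens_add.
Proof.
move=> a x y; rewrite -[x]tens_reprK -[y]tens_reprK.
by rewrite tens_addE !tens_scaleE tens_addE /tens_scale_seq map_cat.
Qed.

Definition tens_opp : tens -> tens := tens_scale (- 1).

Fact tens_addN : left_inverse tens_zero tens_opp tens_add.
Proof. by move=> x; rewrite -{2}[x]tens_scale1 -tens_scaleDl addNr tens_scale0. Qed.

HB.instance Definition _ := GRing.isZmodule.Build tens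
  tens_addA tens_addC tens_add0 tens_addN.

HB.instance Definition _ := GRing.Zmodule_isLmodule.Build K tens
  tens_scaleA tens_scale1 tens_scaleDr tens_scaleDl.

Definition tpure u v : tens := tens_of [:: (u, v)].

Definition bilinear_map (W : lmodType K) (f : U -> V -> W) :=
  (forall v, linear (f^~ v)) /\ (forall u, linear (f u)).

(* The linear map on the tensor product induced by f, for f bilinear (a      *)
(* meaningless value otherwise).                                             *)
Definition tlift (W : lmodType K) (f : U -> V -> W) (x : tens) : W :=
  \sum_(p <- tens_repr x) f p.1 p.2.

Lemma tens_ofE s : tens_of s = \sum_(p <- s) tpure p.1 p.2.
Proof.
elim: s => [|[u v] s IHs]; first by rewrite big_nil.
by rewrite big_cons -IHs; apply/esym/tens_addE.
Qed.

Lemma tens_ind (P : tens -> Prop) :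
  P 0 -> (forall u v, P (tpure u v)) ->
  (forall x y, P x -> P y -> P (x + y)) -> forall x, P x.
Proof.
move=> P0 Pp PD x; rewrite -[x]tens_reprK tens_ofE.
by elim/big_ind: _ => // p _; apply: Pp.
Qed.

Lemma tpure_bilinear : bilinear_map tpure.
Proof.
split=> [v|u] a x y; last first.
  transitivity (tens_add (tens_scale a (tpure u x)) (tpure u y)) => //.
  rewrite tens_scaleE tens_addE /=; apply/tens_ofP.
  apply: TensTrans (TensDr _ _ _) _.
  exact: (TensCat (TensSym (TensZ _ _ _)) (TensRefl [:: _])).
transitivity (tens_add (tens_scale a (tpure x v)) (tpure y v)) => //.
by rewrite tens_scaleE tens_addE /=; apply/tens_ofP/TensDl.
Qed.

Section Lift.
Variables (W : lmodType K) (f : U -> V -> W).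
Hypothesis f_bil : bilinear_map f.

Lemma bilinearDl u u' v : f (u + u') v = f u v + f u' v.
Proof. by have := f_bil.1 v 1 u u'; rewrite !scale1r. Qed.

Lemma bilinearDr u v v' : f u (v + v') = f u v + f u v'.
Proof. by have := f_bil.2 u 1 v v'; rewrite !scale1r. Qed.

Lemma bilinear0l v : f 0 v = 0.
Proof. by apply: (@addrI _ (f 0 v)); rewrite -bilinearDl !addr0. Qed.

Lemma bilinear0r u : f u 0 = 0.
Proof. by apply: (@addrI _ (f u 0)); rewrite -bilinearDr !addr0. Qed.

Lemma bilinearZl a u v : f (a *: u) v = a *: f u v.
Proof. by have := f_bil.1 v a u 0; rewrite bilinear0l !addr0. Qed.

Lemma bilinearZr a u v : f u (a *: v) = a *: f u v.
Proof. by have := f_bil.2 u a v 0; rewrite bilinear0r !addr0. Qed.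

Lemma tlift_of s : tlift f (tens_of s) = \sum_(p <- s) f p.1 p.2.
Proof.
rewrite /tlift; move: (tens_repr _) (tens_of_repr s) => t.
elim=> {s t} //=.
- by move=> s t r _ -> _ ->.
- by move=> s s' t t' _ es _ et; rewrite !big_cat /= es et.
- by move=> s t; rewrite !big_cat /= addrC.
- by move=> u u' v; rewrite !big_cons !big_nil /= bilinearDl !addr0.
- by move=> u v v'; rewrite !big_cons !big_nil /= bilinearDr !addr0.
- by move=> a u v; rewrite !big_seq1 /= bilinearZl bilinearZr.
- by move=> v; rewrite big_seq1 big_nil bilinear0l.
Qed.

Lemma tlift_pure u v : tlift f (tpure u v) = f u v.
Proof. by rewrite tlift_of big_seq1. Qed.

Lemma tlift_linear : linear (tlift f).
Proof.
move=> a x y; rewrite -[x]tens_reprK -[y]tens_reprK.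
have -> : a *: tens_of (tens_repr x) + tens_of (tens_repr y)
  = tens_of (tens_scale_seq a (tens_repr x) ++ tens_repr y).
  by rewrite -tens_addE -tens_scaleE.
rewrite !tlift_of big_cat /= big_map scaler_sumr; congr (_ + _).
by apply: eq_bigr => p _; rewrite bilinearZl.
Qed.

End Lift.

Lemma tens_linear_ext (W : lmodType K) (g h : tens -> W) :
  linear g -> linear h -> (forall u v, g (tpure u v) = h (tpure u v)) -> g =1 h.
Proof.
move=> lg lh gh; apply: tens_ind => [|//|x y ex ey].
  have g0 : g 0 = 0 by apply: (addrI (g 0)); have := lg 1 0 0; rewrite !scale1r !addr0.
  by rewrite g0; apply: (addrI (h 0)); have := lh 1 0 0; rewrite !scale1r !addr0.
by have := lg 1 x y; have := lh 1 x y; rewrite !scale1r => -> ->; rewrite ex ey.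
Qed.

End Tensor.

Arguments tens {K} U V.
Arguments tpure {K U V} u v.
Notation "u ⊗ v" := (tpure u v) (at level 40, left associativity) : ring_scope.

Section TensorMaps.
Variable K : comPzRingType.

Definition tmap (U V U' V' : lmodType K) (f : U -> U') (g : V -> V') :
    tens U V -> tens U' V' :=
  tlift (fun u v => f u ⊗ g v).

Definition tswap (U V : lmodType K) : tens U V -> tens V U :=
  tlift (fun u v => v ⊗ u).

Definition tassoc (U V W : lmodType K) :
    tens (tens U V) W -> tens U (tens V W) :=
  tlift (fun x w => tlift (fun u v => u ⊗ (v ⊗ w)) x).

Lemma linear_id (U : lmodType K) : linear (@id U).
Proof. by []. Qed.

Lemma linear_comp (U V W : lmodType K) (g : V -> W) (f : U -> V) :
  linear g -> linear f -> linear (g \o f).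
Proof. by move=> lg lf a x y /=; rewrite lf lg. Qed.

Lemma linear_raw (U V : lmodType K) (f : U -> V) : linear f ->
  [/\ f 0 = 0, {morph f : x y / x + y} & forall a x, f (a *: x) = a *: f x].
Proof.
move=> lf; have f0 : f 0 = 0.
  by apply: (addrI (f 0)); have := lf 1 0 0; rewrite !scale1r !addr0.
split=> // [x y|a x]; first by have := lf 1 x y; rewrite !scale1r.
by have := lf a x 0; rewrite f0 !addr0.
Qed.

Lemma tmap_bilinear (U V U' V' : lmodType K) (f : U -> U') (g : V -> V') :
  linear f -> linear g -> bilinear_map (fun u v => f u ⊗ g v).
Proof.
move=> lf lg; split=> [v|u] a x y /=.
  by rewrite lf (tpure_bilinear _ _).1.
by rewrite lg (tpure_bilinear _ _).2.
Qed.

Lemma tmap_pure (U V U' V' : lmodType K) (f : U -> U') (g : V -> V') u v :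
  linear f -> linear g -> tmap f g (u ⊗ v) = f u ⊗ g v.
Proof. by move=> lf lg; rewrite /tmap tlift_pure //; apply: tmap_bilinear. Qed.

Lemma tmap_linear (U V U' V' : lmodType K) (f : U -> U') (g : V -> V') :
  linear f -> linear g -> linear (tmap f g).
Proof. by move=> lf lg; apply/tlift_linear/tmap_bilinear. Qed.

Lemma tmap_comp (U V U' V' U'' V'' : lmodType K)
    (f : U -> U') (g : V -> V') (f' : U' -> U'') (g' : V' -> V'') :
  linear f -> linear g -> linear f' -> linear g' ->
  tmap f' g' \o tmap f g =1 tmap (f' \o f) (g' \o g).
Proof.
move=> lf lg lf' lg'; apply: tens_linear_ext => [||u v] /=.
- by apply: linear_comp; apply: tmap_linear.
- by apply: tmap_linear; apply: linear_comp.
by rewrite !tmap_pure //; apply: linear_comp.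
Qed.

Lemma tmap_id (U V : lmodType K) : tmap (@id U) (@id V) =1 id.
Proof.
apply: tens_linear_ext => [||u v] //; first exact: tmap_linear.
by rewrite tmap_pure.
Qed.

Fact tassoc_bilinear_in (U V W : lmodType K) (w : W) :
  bilinear_map (fun (u : U) (v : V) => u ⊗ (v ⊗ w)).
Proof.
split=> [v|u] a x y /=; first by rewrite (tpure_bilinear _ _).1.
by rewrite (tpure_bilinear _ _).1 (tpure_bilinear _ _).2.
Qed.

Fact tassoc_bilinear (U V W : lmodType K) : bilinear_map
  (fun (x : tens U V) (w : W) => tlift (fun u v => u ⊗ (v ⊗ w)) x).
Proof.
split=> [w|x] a y z /=.
  exact: (tlift_linear (@tassoc_bilinear_in U V W w)).
rewrite /tlift scaler_sumr -big_split /=; apply: eq_bigr => -[u v] _ /=.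
by rewrite !(tpure_bilinear _ _).2.
Qed.

Lemma tassoc_linear (U V W : lmodType K) : linear (@tassoc U V W).
Proof. exact/tlift_linear/tassoc_bilinear. Qed.

Lemma tassoc_pure (U V W : lmodType K) (u : U) (v : V) (w : W) :
  tassoc ((u ⊗ v) ⊗ w) = u ⊗ (v ⊗ w).
Proof.
rewrite /tassoc tlift_pure; last exact: tassoc_bilinear.
by rewrite tlift_pure //; apply: tassoc_bilinear_in.
Qed.

Lemma tswap_bilinear (U V : lmodType K) :
  bilinear_map (fun (u : U) (v : V) => v ⊗ u).
Proof.
split=> [v|u] a x y; first by rewrite (tpure_bilinear _ _).2.
by rewrite (tpure_bilinear _ _).1.
Qed.

Lemma tswap_linear (U V : lmodType K) : linear (@tswap U V).
Proof. exact/tlift_linear/tswap_bilinear. Qed.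

Lemma tswap_pure (U V : lmodType K) (u : U) (v : V) : tswap (u ⊗ v) = v ⊗ u.
Proof. by rewrite /tswap tlift_pure //; apply: tswap_bilinear. Qed.

End TensorMaps.

(* Associative unital algebras over K. The library's algType cannot be used:  *)
(* it excludes the zero algebra, hence every algebra over the zero ring.      *)
HB.mixin Record Lmodule_isKAlgebra (K : pzRingType) A of GRing.Lmodule K A := {
  kone : A;
  kmul : A -> A -> A;
  kmulA : associative kmul;
  kmul1l : left_id kone kmul;
  kmul1r : right_id kone kmul;
  kmulDl : left_distributive kmul +%R;
  kmulDr : right_distributive kmul +%R;
  kscaleAl : forall (a : K) (x y : A), a *: kmul x y = kmul (a *: x) y;
  kscaleAr : forall (a : K) (x y : A), a *: kmul x y = kmul x (a *: y)
}.

#[short(type="kalgType")]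
HB.structure Definition KAlgebra (K : pzRingType) :=
  {A of GRing.Lmodule K A & Lmodule_isKAlgebra K A}.

#[non_forgetful_inheritance]
HB.instance Definition _ (K : pzRingType) (A : kalgType K) :=
  GRing.Zmodule_isPzRing.Build (KAlgebra.sort A)
    (@kmulA K A) (@kmul1l K A) (@kmul1r K A) (@kmulDl K A) (@kmulDr K A).

Lemma kscalerAl (K : pzRingType) (A : kalgType K) (a : K) (x y : A) :
  a *: (x * y) = (a *: x) * y.
Proof. exact: kscaleAl. Qed.

Lemma kscalerAr (K : pzRingType) (A : kalgType K) (a : K) (x y : A) :
  a *: (x * y) = x * (a *: y).
Proof. exact: kscaleAr. Qed.

Section RegularAlgebra.
Variable K : comPzRingType.

Fact regular_scaleAl (a : K) (x y : K^o) : a *: (x * y) = (a *: x) * y.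
Proof. exact: mulrA. Qed.

Fact regular_scaleAr (a : K) (x y : K^o) : a *: (x * y) = x * (a *: y).
Proof. exact: mulrCA. Qed.

HB.instance Definition _ := Lmodule_isKAlgebra.Build K K^o
  (@mulrA K) (@mul1r K) (@mulr1 K) (@mulrDl K) (@mulrDr K)
  regular_scaleAl regular_scaleAr.

End RegularAlgebra.

(* The algebra structure (a ⊗ b) * (a' ⊗ b') = (a * a') ⊗ (b * b').           *)
Section TensorAlgebra.
Variables (K : comPzRingType) (A B : kalgType K).
Implicit Types x y z : tens A B.

Definition tone : tens A B := (1 : A) ⊗ (1 : B).

Definition tmul x y : tens A B :=
  tlift (fun (a : A) (b : B) =>
    tlift (fun (a' : A) (b' : B) => (a * a') ⊗ (b * b')) y) x.

Fact tmul_bilinear_r (a : A) (b : B) :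
  bilinear_map (fun (a' : A) (b' : B) => (a * a') ⊗ (b * b')).
Proof.
split=> [v|u] c x y /=; rewrite mulrDr -kscalerAr.
  by rewrite (tpure_bilinear _ _).1.
by rewrite (tpure_bilinear _ _).2.
Qed.

Fact tmul_bilinear_l y : bilinear_map (fun (a : A) (b : B) =>
  tlift (fun (a' : A) (b' : B) => (a * a') ⊗ (b * b')) y).
Proof.
split=> [b|a] c x x'; rewrite /tlift scaler_sumr -big_split /=;
  apply: eq_bigr => -[a' b'] _ /=; rewrite mulrDl -kscalerAl.
  by rewrite (tpure_bilinear _ _).1.
by rewrite (tpure_bilinear _ _).2.
Qed.

Lemma tmul_linear_l y : linear (tmul^~ y).
Proof. exact/tlift_linear/tmul_bilinear_l. Qed.

Lemma tmul_linear_r x : linear (tmul x).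
Proof.
move=> c y z; rewrite /tmul /tlift scaler_sumr -big_split /=.
apply: eq_bigr => -[a b] _ /=.
exact: (tlift_linear (tmul_bilinear_r a b)).
Qed.

Lemma tmul_pure (a a' : A) (b b' : B) :
  tmul (a ⊗ b) (a' ⊗ b') = (a * a') ⊗ (b * b').
Proof.
rewrite /tmul tlift_pure; last exact: tmul_bilinear_l.
by rewrite tlift_pure //; apply: tmul_bilinear_r.
Qed.

Fact tmulDl : left_distributive tmul +%R.
Proof. by move=> x y z; have [_ -> _] := linear_raw (tmul_linear_l z). Qed.

Fact tmulDr : right_distributive tmul +%R.
Proof. by move=> x y z; have [_ -> _] := linear_raw (tmul_linear_r x). Qed.

Fact tmulZl (c : K) x y : c *: tmul x y = tmul (c *: x) y.
Proof. by have [_ _ ->] := linear_raw (tmul_linear_l y). Qed.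

Fact tmulZr (c : K) x y : c *: tmul x y = tmul x (c *: y).
Proof. by have [_ _ ->] := linear_raw (tmul_linear_r x). Qed.

Fact tmul0l x : tmul 0 x = 0.
Proof. by have [-> _ _] := linear_raw (tmul_linear_l x). Qed.

Fact tmul0r x : tmul x 0 = 0.
Proof. by have [-> _ _] := linear_raw (tmul_linear_r x). Qed.

Fact tmulA : associative tmul.
Proof.
move=> x y z; elim/tens_ind: x => [|a b|x x' ex ex'].
- by rewrite !tmul0l.
- elim/tens_ind: y => [|a' b'|y y' ey ey'].
  + by rewrite !(tmul0l, tmul0r).
  + elim/tens_ind: z => [|a'' b''|z z' ez ez'].
    * by rewrite !tmul0r.
    * by rewrite !tmul_pure !mulrA.
    * by rewrite !tmulDr ez ez'.
  + by rewrite !(tmulDl, tmulDr) ey ey'.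
- by rewrite !tmulDl ex ex'.
Qed.

Fact tmul1l : left_id tone tmul.
Proof.
elim/tens_ind=> [|a b|x y ex ey]; first exact: tmul0r.
  by rewrite tmul_pure !mul1r.
by rewrite tmulDr ex ey.
Qed.

Fact tmul1r : right_id tone tmul.
Proof.
elim/tens_ind=> [|a b|x y ex ey]; first exact: tmul0l.
  by rewrite tmul_pure !mulr1.
by rewrite tmulDl ex ey.
Qed.

HB.instance Definition _ := Lmodule_isKAlgebra.Build K (tens A B)
  tmulA tmul1l tmul1r tmulDl tmulDr tmulZl tmulZr.

HB.instance Definition _ :=
  GRing.PzRing.copy (tens A B) (KAlgebra.sort (tens A B : kalgType K)).

End TensorAlgebra.
Record bialgebra (K : comPzRingType) := Bialgebra {
  bialg_alg :> kalgType K;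
  comul : bialg_alg -> tens bialg_alg bialg_alg;
  counit : bialg_alg -> K^o;
  comul_linear : linear comul;
  comul_monoid : monoid_morphism comul;
  counit_linear : linear counit;
  counit_monoid : monoid_morphism counit;
  comulA : forall x, tassoc (tmap comul id (comul x)) = tmap id comul (comul x);
  counit_l : forall x, tlift (fun a b => counit a *: b) (comul x) = x;
  counit_r : forall x, tlift (fun a b => counit b *: a) (comul x) = x
}.

Arguments comul {K b} x.
Arguments counit {K b} x.

Definition cocommutative (K : comPzRingType) (B : bialgebra K) :=
  forall x : B, tswap (comul x) = comul x.

Definition is_antipode (K : comPzRingType) (B : bialgebra K) (S : B -> B) :=
  linear S /\ forall x : B,
    tlift (fun a b : B => S a * b) (comul x) = counit x *: (1 : B) /\
    tlift (fun a b : B => a * S b) (comul x) = counit x *: (1 : B).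

Definition is_hopf (K : comPzRingType) (B : bialgebra K) :=
  exists S : B -> B, is_antipode S.

Definition is_bialg_morphism (K : comPzRingType) (A B : bialgebra K)
    (f : A -> B) :=
  [/\ linear f, monoid_morphism f,
      forall x, comul (f x) = tmap f f (comul x) &
      forall x, counit (f x) = counit x].

Record coc_bialgebra (K : comPzRingType) := CocBialgebra {
  coc_bialg :> bialgebra K;
  coc_comm : cocommutative coc_bialg
}.

Record bialg_hom (K : comPzRingType) (A B : bialgebra K) := BialgHom {
  bialg_fun :> A -> B;
  bialg_funP : is_bialg_morphism bialg_fun
}.

Section BialgCategory.
Variable K : comPzRingType.

Lemma bialg_hom_eq (A B : bialgebra K) (f g : bialg_hom A B) :
  f =1 g -> f = g.
Proof.
case: f g => [f fP] [g gP] /= /funext fg; case: _ / fg gP => gP.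
by rewrite (Prop_irrelevance fP gP).
Qed.

Fact bialg_id_subproof (A : bialgebra K) : is_bialg_morphism (@id A).
Proof. by split=> // x; rewrite tmap_id. Qed.

Definition bialg_id (A : bialgebra K) := BialgHom (bialg_id_subproof A).

Fact bialg_comp_subproof (A B C : bialgebra K)
    (g : bialg_hom B C) (f : bialg_hom A B) : is_bialg_morphism (g \o f).
Proof.
case: f g => f [lf mf cf ef] [g [lg mg cg eg]] /=; split.
- exact: linear_comp.
- by split=> [|x y] /=; rewrite ?mf ?mg // mf.2 mg.2.
- by move=> x /=; rewrite cg cf; apply: (tmap_comp lf lf lg lg).
- by move=> x /=; rewrite eg ef.
Qed.

Definition bialg_comp (A B C : bialgebra K)
    (g : bialg_hom B C) (f : bialg_hom A B) :=
  BialgHom (bialg_comp_subproof g f).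

End BialgCategory.

(* The base ring as a bialgebra: the comultiplication is k |-> k (1 ⊗ 1).     *)
Section TrivialBialgebra.
Variable K : comPzRingType.
Let KA : kalgType K := K^o.

Definition triv_comul (k : KA) : tens KA KA :=
  (k : K) *: ((1 : KA) ⊗ (1 : KA)).

Fact triv_comul_linear : linear triv_comul.
Proof. by move=> a x y; rewrite /triv_comul scalerDl scalerA. Qed.

Fact triv_comul_monoid : monoid_morphism triv_comul.
Proof.
split=> [|x y]; rewrite /triv_comul; first by rewrite scale1r.
by rewrite -kscalerAl -kscalerAr scalerA mul1r.
Qed.

Fact triv_counit_linear : linear (@id KA).
Proof. by []. Qed.

Fact triv_counit_monoid : monoid_morphism (@id KA : KA -> K^o).
Proof. by []. Qed.

Let triv_tmap (V V' : lmodType K) (f : KA -> V) (g : KA -> V') (x : KA) :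
  linear f -> linear g -> tmap f g (triv_comul x) = (x : K) *: (f 1 ⊗ g 1).
Proof.
move=> lf lg; have [_ _ ->] := linear_raw (tmap_linear lf lg).
by rewrite tmap_pure.
Qed.

Fact triv_comulA (x : KA) :
  tassoc (tmap triv_comul id (triv_comul x)) =
  tmap id triv_comul (triv_comul x).
Proof.
rewrite !triv_tmap //; try exact: triv_comul_linear.
have [_ _ ->] := linear_raw (@tassoc_linear K KA KA KA).
by rewrite /triv_comul !scale1r tassoc_pure.
Qed.

Let scale_bilinear : bilinear_map (fun a b : KA => (a : K) *: b).
Proof.
split=> [v|u] a x y; first by rewrite scalerDl scalerA.
by rewrite scalerDr !scalerA mulrC.
Qed.

Let scale_bilinear_r : bilinear_map (fun a b : KA => (b : K) *: a).
Proof. by split=> [v|u]; [apply: scale_bilinear.2 | apply: scale_bilinear.1]. Qed.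

Fact triv_counit_l (x : KA) :
  tlift (fun a b : KA => (a : K) *: b) (triv_comul x) = x.
Proof.
have [_ _ ->] := linear_raw (tlift_linear scale_bilinear).
by rewrite tlift_pure // scale1r; apply: mulr1.
Qed.

Fact triv_counit_r (x : KA) :
  tlift (fun a b : KA => (b : K) *: a) (triv_comul x) = x.
Proof.
have [_ _ ->] := linear_raw (tlift_linear scale_bilinear_r).
by rewrite tlift_pure // scale1r; apply: mulr1.
Qed.

Definition triv_bialgebra : bialgebra K :=
  @Bialgebra K KA triv_comul id triv_comul_linear triv_comul_monoid
    triv_counit_linear triv_counit_monoid triv_comulA triv_counit_l triv_counit_r.

Fact triv_cocommutative : cocommutative triv_bialgebra.
Proof.
move=> x /=; have [_ _ tZ] := linear_raw (@tswap_linear K KA KA).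
by rewrite tZ tswap_pure.
Qed.

Definition triv_coc_bialgebra : coc_bialgebra K :=
  CocBialgebra triv_cocommutative.

Fact unit_subproof (B : bialgebra K) :
  is_bialg_morphism (fun k : triv_bialgebra => (k : K) *: (1 : B)).
Proof.
have lf : linear (fun k : KA => (k : K) *: (1 : B)).
  by move=> a x y; rewrite scalerDl scalerA.
split=> //.
- split=> [|x y]; first exact: scale1r.
  by rewrite -kscalerAl -kscalerAr scalerA mul1r.
- move=> x; rewrite /= triv_tmap // scale1r.
  have [_ _ ->] := linear_raw (@comul_linear K B).
  by rewrite (comul_monoid B).1.
- move=> x; have [_ _ ->] := linear_raw (@counit_linear K B).
  by rewrite (counit_monoid B).1; apply: mulr1.
Qed.

Definition from_triv (B : bialgebra K) : bialg_hom triv_bialgebra B :=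
  BialgHom (unit_subproof B).

Fact from_triv_uniq (B : bialgebra K) (f : bialg_hom triv_bialgebra B) :
  f = from_triv B.
Proof.
apply: bialg_hom_eq => x; case: f => f [lf mf _ _] /=.
by have [_ _ fZ] := linear_raw lf; rewrite -mf.1 -fZ; congr f; apply/esym/mulr1.
Qed.

Fact counit_subproof (B : bialgebra K) :
  @is_bialg_morphism K B triv_bialgebra (@counit K B).
Proof.
have leps := @counit_linear K B.
split=> //; first exact: counit_monoid.
move=> x; rewrite -{1}(counit_l x).
set h := fun a b : B => counit a *: b.
have bh : bilinear_map h.
  split=> [v|u] a y z; rewrite /h; last by rewrite scalerDr !scalerA mulrC.
  by rewrite leps scalerDl -scalerA.
apply: (tens_linear_ext (g := fun t => triv_comul (counit (tlift h t)))).
- apply: (linear_comp triv_comul_linear).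
  by apply: (linear_comp leps); apply: tlift_linear.
- exact: tmap_linear.
move=> a b; rewrite tlift_pure // tmap_pure // /h /triv_comul.
have [_ _ ->] := linear_raw leps.
rewrite -{2}[counit a]mulr1 -{2}[counit b]mulr1.
rewrite (bilinearZl (@tpure_bilinear K KA KA)).
by rewrite (bilinearZr (@tpure_bilinear K KA KA)) scalerA.
Qed.

Definition to_triv (B : bialgebra K) : bialg_hom B triv_bialgebra :=
  BialgHom (counit_subproof B).

Fact to_triv_uniq (B : bialgebra K) (f : bialg_hom B triv_bialgebra) :
  f = to_triv B.
Proof.
by apply: bialg_hom_eq => x; case: f => f [_ _ _ ef] /=; rewrite -ef.
Qed.

End TrivialBialgebra.

Record category := Category {
  obj :> Type;
  hom : obj -> obj -> Type;
  idm : forall X, hom X X;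
  mcomp : forall X Y Z, hom Y Z -> hom X Y -> hom X Z;
  compA : forall X Y Z T (h : hom Z T) (g : hom Y Z) (f : hom X Y),
    mcomp h (mcomp g f) = mcomp (mcomp h g) f;
  compl1 : forall X Y (f : hom X Y), mcomp (idm Y) f = f;
  compr1 : forall X Y (f : hom X Y), mcomp f (idm X) = f
}.

Arguments hom {c} X Y.
Arguments idm {c} X.
Arguments mcomp {c X Y Z} g f.

Declare Scope cat_scope.
Delimit Scope cat_scope with cat.
Notation "g ∘ f" := (mcomp g f) (at level 40, left associativity) : cat_scope.

Record pointed_category := PointedCategory {
  pointed_cat :> category;
  zero_obj : pointed_cat;
  from_zero : forall X : pointed_cat, hom zero_obj X;
  to_zero : forall X : pointed_cat, hom X zero_obj;
  from_zero_unique : forall X (f : hom zero_obj X), f = from_zero X;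
  to_zero_unique : forall X (f : hom X zero_obj), f = to_zero X
}.

Section Protomodular.
Variable C : pointed_category.
Implicit Types W X Y Z : C.
Local Open Scope cat_scope.

Definition zero_mor X Y : hom X Y := from_zero Y ∘ to_zero X.

Definition is_mono X Y (m : hom X Y) :=
  forall Z (g h : hom Z X), m ∘ g = m ∘ h -> g = h.

Definition is_iso X Y (f : hom X Y) :=
  exists g : hom Y X, g ∘ f = idm X /\ f ∘ g = idm Y.

Definition is_kernel X Y (f : hom X Y) N (k : hom N X) :=
  f ∘ k = zero_mor N Y /\
  forall Z (h : hom Z X), f ∘ h = zero_mor Z Y ->
    exists! h' : hom Z N, k ∘ h' = h.

Definition is_pullback W X Y (g : hom W Y) (f : hom X Y)
    P (p : hom P W) (q : hom P X) :=
  g ∘ p = f ∘ q /\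
  forall Z (u : hom Z W) (v : hom Z X), g ∘ u = f ∘ v ->
    exists! h : hom Z P, p ∘ h = u /\ q ∘ h = v.

Definition jointly_extremally_epic N X Y (k : hom N X) (s : hom Y X) :=
  forall M (m : hom M X), is_mono m ->
    (exists k' : hom N M, m ∘ k' = k) ->
    (exists s' : hom Y M, m ∘ s' = s) -> is_iso m.

Record split_extension Y := SplitExtension {
  se_ker : C;
  se_mid : C;
  se_k : hom se_ker se_mid;
  se_f : hom se_mid Y;
  se_s : hom Y se_mid;
  se_kernel : is_kernel se_f se_k;
  se_split : se_f ∘ se_s = idm Y
}.

Definition strong Y (E : split_extension Y) :=
  jointly_extremally_epic (se_k E) (se_s E).

(* E' is a pullback of E along g, up to the choice of the pullback object and *)
(* of the kernel of its projection to W: the section of E' is <1_W, s ∘ g>.   *)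
Definition is_pullback_extension W Y (g : hom W Y)
    (E : split_extension Y) (E' : split_extension W) :=
  exists q : hom (se_mid E') (se_mid E),
    is_pullback g (se_f E) (se_f E') q /\ q ∘ se_s E' = se_s E ∘ g.

Definition stably_strong Y (E : split_extension Y) :=
  forall W (g : hom W Y) (E' : split_extension W),
    is_pullback_extension g E E' -> strong E'.

Definition protomodular_object Y :=
  forall E : split_extension Y, stably_strong E.

End Protomodular.

Section BialgCoc.
Variable K : comPzRingType.

Definition bialg_coc_category : category.
Proof.
refine (@Category (coc_bialgebra K) (fun A B => bialg_hom A B)
  (fun A => bialg_id A) (fun A B C g f => bialg_comp g f) _ _ _).
- by move=> *; apply: bialg_hom_eq.
- by move=> *; apply: bialg_hom_eq.
- by move=> *; apply: bialg_hom_eq.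
Defined.

Definition BiAlgCoc : pointed_category :=
  @PointedCategory bialg_coc_category (triv_coc_bialgebra K)
    (fun B => from_triv (coc_bialg B)) (fun B => to_triv (coc_bialg B))
    (fun B f => from_triv_uniq f) (fun B f => to_triv_uniq f).

End BialgCoc.

Arguments protomodular_object {C} Y.

(* Main.v *)
Require Import Defs.
From HB Require Import structures.
From mathcomp Require Import all_boot all_order all_algebra.
From mathcomp Require Import boolp.

Set Implicit Arguments.
Unset Strict Implicit.
Unset Printing Implicit Defensive.

Import GRing.Theory.
Local Open Scope ring_scope.
Local Open Scope quotient_scope.

(** Cocommutative bialgebras are the internal monoids, and cocommutative Hopf
algebras the internal groups, of the cartesian category of cocommutative
coalgebras, so one can argue with generalized elements as one would for
ordinary monoids. Let P be the pullback of a split extension (f, s) over H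
along g : W -> H, that is, the monoid of all pairs (w, x) with g w = f x.
Since H is a group,
<<
  (w, x) = (1, x * s (g w)^-1) * (w, s (g w)),
>>
where the first factor lies in the kernel of the projection to W and the
second in the image of its section. A subobject m : M -> P that contains this
kernel and the image of this section therefore contains every element.

A generalized element is here a coalgebra morphism out of a cocommutative
bialgebra; generalized elements are multiplied by convolution
([coalg_conv]), and inverted in H by composition with the antipode
([antipode_coalg]). The decomposition above gives a coalgebra morphism
r : P -> M with m r = 1. It is not multiplicative a priori, which is where the
difficulty lies: pullbacks, kernels and monomorphisms are only known to behave
well with respect to bialgebra morphisms, and over an arbitrary ring they have
no description in terms of submodules of tensor products, as tensoring does
not preserve injections.

The remedy is that the forgetful functor to cocommutative coalgebras has a
left adjoint, the tensor algebra. A coalgebra morphism Z -> X is the same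
thing as a bialgebra morphism T(Z) -> X ([talg_ext_bialg], [coalg_ext_eq]), so
the universal properties of pullbacks and kernels and the cancellation
property of monomorphisms hold for coalgebra morphisms too
([pullback_coalg], [kernel_coalg], [mono_coalg]). Then r exists, and m r m = m
yields r m = 1, so that m is bijective with inverse r; the inverse of a
bijective algebra morphism is an algebra morphism, hence m is an isomorphism
of bialgebras ([coalg_inverse_iso]). *)

(** * The tensor algebra of a module *)

Section TensorAlgebraOfModule.
Variables (K : comPzRingType) (V : lmodType K).

(** T(V) is presented by generators and relations rather than as the direct sum
of the tensor powers of V: all that matters below is its universal property,
which is the recursion principle of terms. *)
Inductive alg_term : Type :=
| AVar of V
| AZero
| AOne
| AAdd of alg_term & alg_term
| AMul of alg_term & alg_term
| AScale of K & alg_term.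

HB.instance Definition _ := gen_eqMixin alg_term.
HB.instance Definition _ := gen_choiceMixin alg_term.

Inductive alg_eq : alg_term -> alg_term -> Prop :=
| AERefl x : alg_eq x x
| AESym x y : alg_eq x y -> alg_eq y x
| AETrans x y z : alg_eq x y -> alg_eq y z -> alg_eq x z
| AEAdd x x' y y' : alg_eq x x' -> alg_eq y y' -> alg_eq (AAdd x y) (AAdd x' y')
| AEMul x x' y y' : alg_eq x x' -> alg_eq y y' -> alg_eq (AMul x y) (AMul x' y')
| AEScale a x x' : alg_eq x x' -> alg_eq (AScale a x) (AScale a x')
| AEAddA x y z : alg_eq (AAdd x (AAdd y z)) (AAdd (AAdd x y) z)
| AEAddC x y : alg_eq (AAdd x y) (AAdd y x)
| AEAdd0 x : alg_eq (AAdd AZero x) x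
| AEScale0 x : alg_eq (AScale 0 x) AZero
| AEScale1 x : alg_eq (AScale 1 x) x
| AEScaleA a b x : alg_eq (AScale a (AScale b x)) (AScale (a * b) x)
| AEScaleDr a x y :
    alg_eq (AScale a (AAdd x y)) (AAdd (AScale a x) (AScale a y))
| AEScaleDl a b x : alg_eq (AScale (a + b) x) (AAdd (AScale a x) (AScale b x))
| AEMulA x y z : alg_eq (AMul x (AMul y z)) (AMul (AMul x y) z)
| AEMul1l x : alg_eq (AMul AOne x) x
| AEMul1r x : alg_eq (AMul x AOne) x
| AEMulDl x y z : alg_eq (AMul (AAdd x y) z) (AAdd (AMul x z) (AMul y z))
| AEMulDr x y z : alg_eq (AMul x (AAdd y z)) (AAdd (AMul x y) (AMul x z))
| AEScaleAl a x y : alg_eq (AScale a (AMul x y)) (AMul (AScale a x) y)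
| AEScaleAr a x y : alg_eq (AScale a (AMul x y)) (AMul x (AScale a y))
| AEVar a u v :
    alg_eq (AVar (a *: u + v)) (AAdd (AScale a (AVar u)) (AVar v)).

Definition alg_eqb x y := `[< alg_eq x y >].

Fact alg_eqb_refl : reflexive alg_eqb.
Proof. by move=> x; apply/asboolP/AERefl. Qed.

Fact alg_eqb_sym : symmetric alg_eqb.
Proof. by move=> x y; apply/asboolP/asboolP; apply: AESym. Qed.

Fact alg_eqb_trans : transitive alg_eqb.
Proof. by move=> y x z /asboolP xy /asboolP yz; apply/asboolP/AETrans/yz. Qed.

Definition alg_rel : equiv_rel alg_term :=
  EquivRel alg_eqb alg_eqb_refl alg_eqb_sym alg_eqb_trans.

Definition talg : Type := {eq_quot alg_rel}.
HB.instance Definition _ := Choice.on talg.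

Definition talg_of (x : alg_term) : talg := \pi x.
Definition talg_repr (x : talg) : alg_term := repr x.

Lemma talg_reprK : cancel talg_repr talg_of.
Proof. by move=> x; apply: reprK. Qed.

Lemma talg_ofP x y : talg_of x = talg_of y <-> alg_eq x y.
Proof. by split=> [/eqquotP/asboolP|xy] //; apply/eqquotP/asboolP. Qed.

Lemma talg_of_repr x : alg_eq (talg_repr (talg_of x)) x.
Proof. by apply/talg_ofP; rewrite talg_reprK. Qed.

Definition talg_zero := talg_of AZero.
Definition talg_one := talg_of AOne.
Definition talg_add x y := talg_of (AAdd (talg_repr x) (talg_repr y)).
Definition talg_mul x y := talg_of (AMul (talg_repr x) (talg_repr y)).
Definition talg_scale a x := talg_of (AScale a (talg_repr x)).
Definition talg_opp := talg_scale (- 1).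

Lemma talg_addE x y : talg_add (talg_of x) (talg_of y) = talg_of (AAdd x y).
Proof. by apply/talg_ofP/AEAdd; apply: talg_of_repr. Qed.

Lemma talg_mulE x y : talg_mul (talg_of x) (talg_of y) = talg_of (AMul x y).
Proof. by apply/talg_ofP/AEMul; apply: talg_of_repr. Qed.

Lemma talg_scaleE a x : talg_scale a (talg_of x) = talg_of (AScale a x).
Proof. exact/talg_ofP/AEScale/talg_of_repr. Qed.

Let talgE := (talg_addE, talg_mulE, talg_scaleE).

Lemma talg_ofE (P : talg -> Prop) : (forall x, P (talg_of x)) -> forall x, P x.
Proof. by move=> H x; rewrite -[x]talg_reprK. Qed.

Fact talg_addA : associative talg_add.
Proof.
elim/talg_ofE=> x; elim/talg_ofE=> y; elim/talg_ofE=> z.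
by rewrite !talgE; apply/talg_ofP/AEAddA.
Qed.

Fact talg_addC : commutative talg_add.
Proof. by move=> x y; apply/talg_ofP/AEAddC. Qed.

Fact talg_add0 : left_id talg_zero talg_add.
Proof. by elim/talg_ofE=> x; rewrite !talgE; apply/talg_ofP/AEAdd0. Qed.

Fact talg_scaleA a b x : talg_scale a (talg_scale b x) = talg_scale (a * b) x.
Proof. by elim/talg_ofE: x => x; rewrite !talgE; apply/talg_ofP/AEScaleA. Qed.

Fact talg_scale1 : left_id 1 talg_scale.
Proof. by elim/talg_ofE=> x; rewrite !talgE; apply/talg_ofP/AEScale1. Qed.

Fact talg_scaleDr : right_distributive talg_scale talg_add.
Proof.
move=> a; elim/talg_ofE=> x; elim/talg_ofE=> y.
by rewrite !talgE; apply/talg_ofP/AEScaleDr.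
Qed.

Fact talg_scaleDl x a b :
  talg_scale (a + b) x = talg_add (talg_scale a x) (talg_scale b x).
Proof. by elim/talg_ofE: x => x; rewrite !talgE; apply/talg_ofP/AEScaleDl. Qed.

Fact talg_addN : left_inverse talg_zero talg_opp talg_add.
Proof.
move=> x; rewrite -{2}[x]talg_scale1 -talg_scaleDl addNr.
by elim/talg_ofE: x => x; rewrite !talgE; apply/talg_ofP/AEScale0.
Qed.

HB.instance Definition _ := GRing.isZmodule.Build talg
  talg_addA talg_addC talg_add0 talg_addN.

HB.instance Definition _ := GRing.Zmodule_isLmodule.Build K talg
  talg_scaleA talg_scale1 talg_scaleDr talg_scaleDl.

Fact talg_mulA : associative talg_mul.
Proof.
elim/talg_ofE=> x; elim/talg_ofE=> y; elim/talg_ofE=> z.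
by rewrite !talgE; apply/talg_ofP/AEMulA.
Qed.

Fact talg_mul1l : left_id talg_one talg_mul.
Proof. by elim/talg_ofE=> x; rewrite !talgE; apply/talg_ofP/AEMul1l. Qed.

Fact talg_mul1r : right_id talg_one talg_mul.
Proof. by elim/talg_ofE=> x; rewrite !talgE; apply/talg_ofP/AEMul1r. Qed.

Fact talg_mulDl : left_distributive talg_mul +%R.
Proof.
elim/talg_ofE=> x; elim/talg_ofE=> y; elim/talg_ofE=> z.
change (talg_mul (talg_add (talg_of x) (talg_of y)) (talg_of z) =
  talg_add (talg_mul (talg_of x) (talg_of z))
           (talg_mul (talg_of y) (talg_of z))).
by rewrite !talgE; apply/talg_ofP/AEMulDl.
Qed.

Fact talg_mulDr : right_distributive talg_mul +%R.
Proof.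
elim/talg_ofE=> x; elim/talg_ofE=> y; elim/talg_ofE=> z.
change (talg_mul (talg_of x) (talg_add (talg_of y) (talg_of z)) =
  talg_add (talg_mul (talg_of x) (talg_of y))
           (talg_mul (talg_of x) (talg_of z))).
by rewrite !talgE; apply/talg_ofP/AEMulDr.
Qed.

Fact talg_scaleAl (a : K) (x y : talg) :
  a *: talg_mul x y = talg_mul (a *: x) y.
Proof.
elim/talg_ofE: x => x; elim/talg_ofE: y => y.
change (talg_scale a (talg_mul (talg_of x) (talg_of y)) =
        talg_mul (talg_scale a (talg_of x)) (talg_of y)).
by rewrite !talgE; apply/talg_ofP/AEScaleAl.
Qed.

Fact talg_scaleAr (a : K) (x y : talg) :
  a *: talg_mul x y = talg_mul x (a *: y).
Proof.
elim/talg_ofE: x => x; elim/talg_ofE: y => y.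
change (talg_scale a (talg_mul (talg_of x) (talg_of y)) =
        talg_mul (talg_of x) (talg_scale a (talg_of y))).
by rewrite !talgE; apply/talg_ofP/AEScaleAr.
Qed.

HB.instance Definition _ := Lmodule_isKAlgebra.Build K talg
  talg_mulA talg_mul1l talg_mul1r talg_mulDl talg_mulDr
  talg_scaleAl talg_scaleAr.

HB.instance Definition _ :=
  GRing.PzRing.copy talg (KAlgebra.sort (talg : kalgType K)).

Definition talg_in (v : V) : talg := talg_of (AVar v).

Lemma talg_in_linear : linear talg_in.
Proof.
move=> a u v.
transitivity (talg_add (talg_scale a (talg_in u)) (talg_in v)) => //.
by rewrite /talg_in !talgE; apply/talg_ofP/AEVar.
Qed.

Lemma talg_ind (P : talg -> Prop) :
  (forall v, P (talg_in v)) -> P 1 ->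
  (forall x y, P x -> P y -> P (x + y)) ->
  (forall x y, P x -> P y -> P (x * y)) ->
  (forall a x, P x -> P (a *: x)) -> forall x, P x.
Proof.
move=> PV P1 PD PM PZ; elim/talg_ofE; elim=> [v|||x Px y Py|x Px y Py|a x Px].
- exact: PV.
- have -> : talg_of AZero = (0 : K) *: (1 : talg) by rewrite scale0r.
  exact: PZ.
- exact: P1.
- by rewrite -talg_addE; apply: PD.
- by rewrite -talg_mulE; apply: PM.
- by rewrite -talg_scaleE; apply: PZ.
Qed.

Section Extension.
Variables (A : kalgType K) (f : V -> A).

Fixpoint alg_eval (x : alg_term) : A :=
  match x with
  | AVar v => f v
  | AZero => 0
  | AOne => 1
  | AAdd x y => alg_eval x + alg_eval y
  | AMul x y => alg_eval x * alg_eval y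
  | AScale a x => a *: alg_eval x
  end.

Definition talg_ext (x : talg) : A := alg_eval (talg_repr x).

Hypothesis lf : linear f.

Lemma alg_eval_eq x y : alg_eq x y -> alg_eval x = alg_eval y.
Proof.
elim=> {x y} //=.
- by move=> x y z _ -> _ ->.
- by move=> x x' y y' _ -> _ ->.
- by move=> x x' y y' _ -> _ ->.
- by move=> a x x' _ ->.
- by move=> x y z; rewrite addrA.
- by move=> x y; rewrite addrC.
- by move=> x; rewrite add0r.
- by move=> x; rewrite scale0r.
- by move=> x; rewrite scale1r.
- by move=> a b x; rewrite scalerA.
- by move=> a x y; rewrite scalerDr.
- by move=> a b x; rewrite scalerDl.
- by move=> x y z; rewrite mulrA.
- by move=> x; rewrite mul1r.
- by move=> x; rewrite mulr1.
- by move=> x y z; rewrite mulrDl.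
- by move=> x y z; rewrite mulrDr.
- by move=> a x y; rewrite kscalerAl.
- by move=> a x y; rewrite kscalerAr.
Qed.

Lemma talg_ext_of x : talg_ext (talg_of x) = alg_eval x.
Proof. exact/alg_eval_eq/talg_of_repr. Qed.

Lemma talg_ext_in v : talg_ext (talg_in v) = f v.
Proof. exact: talg_ext_of. Qed.

Lemma talg_ext_linear : linear talg_ext.
Proof.
move=> a; elim/talg_ofE=> x; elim/talg_ofE=> y.
transitivity (talg_ext (talg_of (AAdd (AScale a x) y))).
  by congr talg_ext; rewrite -talg_addE -talg_scaleE.
by rewrite !talg_ext_of.
Qed.

Lemma talg_ext_monoid : monoid_morphism talg_ext.
Proof.
split; first exact: talg_ext_of.
elim/talg_ofE=> x; elim/talg_ofE=> y.
transitivity (talg_ext (talg_of (AMul x y))).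
  by congr talg_ext; rewrite -talg_mulE.
by rewrite !talg_ext_of.
Qed.

End Extension.

(** This uniqueness principle reduces every identity between algebra morphisms
out of T(V), such as the bialgebra axioms, to a computation on V. *)
Lemma talg_hom_ext (A : kalgType K) (f g : talg -> A) :
  linear f -> linear g -> monoid_morphism f -> monoid_morphism g ->
  (forall v, f (talg_in v) = g (talg_in v)) -> f =1 g.
Proof.
move=> lf lg mf mg fg.
have [_ fD fZ] := linear_raw lf; have [_ gD gZ] := linear_raw lg.
elim/talg_ind=> [//||x y ex ey|x y ex ey|a x ex].
- by rewrite mf.1 mg.1.
- by rewrite fD gD ex ey.
- by rewrite mf.2 mg.2 ex ey.
- by rewrite fZ gZ ex.
Qed.

End TensorAlgebraOfModule.

(** * Algebra morphisms on tensor products *)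

Section TensorAlgebraMorphisms.
Variable K : comPzRingType.
Implicit Types A B C : kalgType K.

Lemma monoid_comp A B C (g : B -> C) (f : A -> B) :
  monoid_morphism g -> monoid_morphism f -> monoid_morphism (g \o f).
Proof. by move=> mg mf; split=> [|x y] /=; rewrite ?mf ?mg // mf.2 mg.2. Qed.

Lemma tpure_mul A B (a a' : A) (b b' : B) :
  (a ⊗ b) * (a' ⊗ b') = (a * a') ⊗ (b * b').
Proof. exact: tmul_pure. Qed.

Lemma tens_monoid A B C (h : tens A B -> C) :
  linear h -> h ((1 : A) ⊗ (1 : B)) = 1 ->
  (forall (a : A) (b : B) (a' : A) (b' : B),
    h ((a * a') ⊗ (b * b')) = h (a ⊗ b) * h (a' ⊗ b')) ->
  monoid_morphism h.
Proof.
move=> lh h1 hM; have [h0 hD _] := linear_raw lh.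
split=> // x y; elim/tens_ind: x => [|a b|x x' ex ex'].
- by rewrite mul0r h0 mul0r.
- elim/tens_ind: y => [|a' b'|y y' ey ey'].
  + by rewrite mulr0 h0 mulr0.
  + by rewrite tpure_mul.
  + by rewrite mulrDr !hD mulrDr ey ey'.
- by rewrite mulrDl !hD mulrDl ex ex'.
Qed.

Lemma tmap_monoid A B A' B' (f : A -> A') (g : B -> B') :
  linear f -> linear g -> monoid_morphism f -> monoid_morphism g ->
  monoid_morphism (tmap f g).
Proof.
move=> lf lg mf mg; apply: tens_monoid => [||a b a' b'].
- exact: tmap_linear.
- by rewrite tmap_pure // mf.1 mg.1.
- by rewrite !tmap_pure // mf.2 mg.2 tpure_mul.
Qed.

Lemma tswap_monoid A B : monoid_morphism (@tswap K A B).
Proof.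
apply: tens_monoid => [||a b a' b']; first exact: tswap_linear.
  by rewrite tswap_pure.
by rewrite !tswap_pure tpure_mul.
Qed.

Lemma tassoc_monoid A B C : monoid_morphism (@tassoc K A B C).
Proof.
have lt := @tassoc_linear K A B C; have [t0 tD _] := linear_raw lt.
have bl (U V : lmodType K) := bilinearDl (@tpure_bilinear K U V).
have b0 (U V : lmodType K) := bilinear0l (@tpure_bilinear K U V).
apply: tens_monoid => [//||a b a' b']; first by rewrite tassoc_pure.
elim/tens_ind: a => [|a1 a2|x x' ex ex'].
- by rewrite mul0r !b0 t0 mul0r.
- elim/tens_ind: a' => [|a1' a2'|y y' ey ey'].
  + by rewrite mulr0 !b0 t0 mulr0.
  + by rewrite tpure_mul !tassoc_pure !tpure_mul.
  + by rewrite mulrDr !bl !tD mulrDr ey ey'.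
- by rewrite mulrDl !bl !tD mulrDl ex ex'.
Qed.

Lemma scale_bilinear_l (U V : lmodType K) (e : U -> K^o) :
  linear e -> bilinear_map (fun (u : U) (v : V) => (e u : K) *: v).
Proof.
move=> le; split=> [v|u] a x y; last by rewrite scalerDr !scalerA mulrC.
by rewrite le scalerDl -scalerA.
Qed.

Lemma scale_bilinear_r (U V : lmodType K) (e : V -> K^o) :
  linear e -> bilinear_map (fun (u : U) (v : V) => (e v : K) *: u).
Proof.
move=> le; split=> [v|u] a x y; first by rewrite scalerDr !scalerA mulrC.
by rewrite le scalerDl -scalerA.
Qed.

Lemma kscale_mul A (a b : K) (x y : A) :
  (a *: x) * (b *: y) = (a * b) *: (x * y).
Proof. by rewrite -kscalerAl -kscalerAr scalerA. Qed.

(** For e a counit, this is the map occurring in a counit axiom, which can thus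
be tested on generators. *)
Lemma scale_monoid_l A B (e : A -> K^o) :
  linear e -> monoid_morphism e ->
  monoid_morphism (tlift (fun (a : A) (b : B) => (e a : K) *: b)).
Proof.
move=> le me; have be := scale_bilinear_l B le.
apply: tens_monoid => [||a b a' b']; first exact: tlift_linear.
  by rewrite tlift_pure // me.1 scale1r.
by rewrite !tlift_pure // me.2 kscale_mul.
Qed.

Lemma scale_monoid_r A B (e : B -> K^o) :
  linear e -> monoid_morphism e ->
  monoid_morphism (tlift (fun (a : A) (b : B) => (e b : K) *: a)).
Proof.
move=> le me; have be := scale_bilinear_r A le.
apply: tens_monoid => [||a b a' b']; first exact: tlift_linear.
  by rewrite tlift_pure // me.1 scale1r.
by rewrite !tlift_pure // me.2 kscale_mul.
Qed.

Lemma tassoc_tmap (U V W U' V' W' : lmodType K)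
    (f : U -> U') (g : V -> V') (h : W -> W') :
  linear f -> linear g -> linear h ->
  forall x, tassoc (tmap (tmap f g) h x) = tmap f (tmap g h) (tassoc x).
Proof.
move=> lf lg lh.
have lfg := tmap_linear lf lg; have lgh := tmap_linear lg lh.
have lL := linear_comp (@tassoc_linear K U' V' W') (tmap_linear lfg lh).
have lR := linear_comp (tmap_linear lf lgh) (@tassoc_linear K U V W).
apply: (tens_linear_ext lL lR) => x w /=.
have lw (X Y : lmodType K) (y : Y) : linear (fun x : X => x ⊗ y) :=
  (@tpure_bilinear K X Y).1 y.
apply: (tens_linear_ext (linear_comp lL (lw _ _ w))
  (linear_comp lR (lw _ _ w))).
by move=> u v; rewrite /= tmap_pure // tmap_pure // !tassoc_pure !tmap_pure.
Qed.

End TensorAlgebraMorphisms.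

(** * Coalgebra morphisms and the tensor bialgebra *)

Definition is_coalg_morphism (K : comPzRingType) (A B : bialgebra K)
    (f : A -> B) :=
  [/\ linear f, forall x, comul (f x) = tmap f f (comul x) &
      forall x, counit (f x) = counit x].

Lemma bialg_coalg (K : comPzRingType) (A B : bialgebra K) (f : bialg_hom A B) :
  is_coalg_morphism f.
Proof. by case: f => f []. Qed.

Lemma coalg_comp (K : comPzRingType) (A B C : bialgebra K)
    (g : B -> C) (f : A -> B) :
  is_coalg_morphism g -> is_coalg_morphism f -> is_coalg_morphism (g \o f).
Proof.
case=> lg cg eg [lf cf ef]; split; first exact: linear_comp.
  by move=> x /=; rewrite cg cf; apply: (tmap_comp lf lf lg lg).
by move=> x /=; rewrite eg ef.
Qed.

(** For a bialgebra B, the coalgebra structure of B (its product is forgotten)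
extends to T(B), making it the free bialgebra on the coalgebra B. *)
Section TensorBialgebra.
Variables (K : comPzRingType) (B : bialgebra K).
Let T : kalgType K := talg B.
Let iota : B -> T := @talg_in K B.
Let l_iota : linear iota := @talg_in_linear K B.

Let comul_gen (b : B) : tens T T := tmap iota iota (comul b).

Let comul_gen_linear : linear comul_gen.
Proof.
exact: (linear_comp (tmap_linear l_iota l_iota) (@comul_linear K B)).
Qed.

Definition talg_comul : T -> tens T T := talg_ext comul_gen.
Definition talg_counit : T -> K^o := talg_ext (@counit K B).

Fact talg_comul_in b : talg_comul (iota b) = tmap iota iota (comul b).
Proof. exact: talg_ext_in. Qed.

Fact talg_counit_in b : talg_counit (iota b) = counit b.
Proof. exact/talg_ext_in/counit_linear. Qed.

Fact talg_comul_linear : linear talg_comul.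
Proof. exact: talg_ext_linear. Qed.

Fact talg_comul_monoid : monoid_morphism talg_comul.
Proof. exact: talg_ext_monoid. Qed.

Fact talg_counit_linear : linear talg_counit.
Proof. exact/talg_ext_linear/counit_linear. Qed.

Fact talg_counit_monoid : monoid_morphism talg_counit.
Proof. exact/talg_ext_monoid/counit_linear. Qed.

Let lc := talg_comul_linear.
Let mc := talg_comul_monoid.
Let le := talg_counit_linear.
Let me := talg_counit_monoid.
Let lB := @comul_linear K B.
Let lid : linear (@id T) := linear_id (U := T).
Let mid : monoid_morphism (@id T).
Proof. by []. Qed.

(** Both sides are algebra morphisms of x, and on generators the claim is the
coassociativity of B pushed forward along the inclusion of B into T(B). *)
Fact talg_comulA x :
  tassoc (tmap talg_comul id (talg_comul x)) =
  tmap id talg_comul (talg_comul x).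
Proof.
move: x; apply: talg_hom_ext => [||||b].
- exact: (linear_comp (@tassoc_linear K T T T)
    (linear_comp (tmap_linear lc lid) lc)).
- exact: (linear_comp (tmap_linear lid lc) lc).
- exact: (monoid_comp (@tassoc_monoid K T T T)
    (monoid_comp (tmap_monoid lc lid mc mid) mc)).
- exact: (monoid_comp (tmap_monoid lid lc mid mc) mc).
rewrite -/(iota b) talg_comul_in.
have comul_iota : talg_comul \o iota = tmap iota iota \o @comul K B.
  by apply/funext => c; apply: talg_comul_in.
have lii := tmap_linear l_iota l_iota.
have lidB : linear (@id B) := linear_id (U := B).
rewrite [X in tassoc X](tmap_comp l_iota l_iota lc lid).
rewrite [RHS](tmap_comp l_iota l_iota lid lc) comul_iota.
rewrite -[iota in LHS]/(iota \o id) -[id \o iota in RHS]/(iota \o id).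
rewrite -(tmap_comp lB lidB lii l_iota) -(tmap_comp lidB lB l_iota lii) /=.
by rewrite tassoc_tmap // comulA.
Qed.

Fact talg_counit_l x :
  tlift (fun a b : T => (talg_counit a : K) *: b) (talg_comul x) = x.
Proof.
have bT := scale_bilinear_l T le.
have bB := scale_bilinear_l B (@counit_linear K B).
move: x; apply: talg_hom_ext => [||||b] //.
- exact: (linear_comp (tlift_linear bT) lc).
- exact: (monoid_comp (scale_monoid_l T le me) mc).
rewrite -/(iota b) talg_comul_in -[in RHS](counit_l b).
apply: (tens_linear_ext
  (linear_comp (tlift_linear bT) (tmap_linear l_iota l_iota))
  (linear_comp l_iota (tlift_linear bB))) => u v /=.
rewrite tmap_pure // !tlift_pure // talg_counit_in.
by have [_ _ ->] := linear_raw l_iota.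
Qed.

Fact talg_counit_r x :
  tlift (fun a b : T => (talg_counit b : K) *: a) (talg_comul x) = x.
Proof.
have bT := scale_bilinear_r T le.
have bB := scale_bilinear_r B (@counit_linear K B).
move: x; apply: talg_hom_ext => [||||b] //.
- exact: (linear_comp (tlift_linear bT) lc).
- exact: (monoid_comp (scale_monoid_r T le me) mc).
rewrite -/(iota b) talg_comul_in -[in RHS](counit_r b).
apply: (tens_linear_ext
  (linear_comp (tlift_linear bT) (tmap_linear l_iota l_iota))
  (linear_comp l_iota (tlift_linear bB))) => u v /=.
rewrite tmap_pure // !tlift_pure // talg_counit_in.
by have [_ _ ->] := linear_raw l_iota.
Qed.

Definition tensor_bialgebra : bialgebra K :=
  @Bialgebra K T talg_comul talg_counit talg_comul_linear talg_comul_monoid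
    talg_counit_linear talg_counit_monoid talg_comulA
    talg_counit_l talg_counit_r.

Lemma tensor_cocommutative : cocommutative B -> cocommutative tensor_bialgebra.
Proof.
move=> cB; apply: talg_hom_ext => [||||b] //=.
- exact: (linear_comp (@tswap_linear K T T) lc).
- exact: (monoid_comp (@tswap_monoid K T T) mc).
rewrite -/(iota b) talg_comul_in -[in RHS](cB b).
apply: (tens_linear_ext
  (linear_comp (@tswap_linear K T T) (tmap_linear l_iota l_iota))
  (linear_comp (tmap_linear l_iota l_iota) (@tswap_linear K B B))) => u v /=.
by rewrite tswap_pure !tmap_pure // tswap_pure.
Qed.

Lemma talg_in_coalg : @is_coalg_morphism K B tensor_bialgebra iota.
Proof. by split; [|apply: talg_comul_in|apply: talg_counit_in]. Qed.

(** The adjunction: compatibility of the extension with the comultiplications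
and counits need only be tested on generators, where it is the hypothesis
on f. *)
Lemma talg_ext_bialg (A : bialgebra K) (f : B -> A) :
  is_coalg_morphism f -> @is_bialg_morphism K tensor_bialgebra A (talg_ext f).
Proof.
case=> lf cf ef.
have lF := talg_ext_linear lf; have mF := talg_ext_monoid lf.
have lcA := @comul_linear K A; have mcA := @comul_monoid K A.
have leA := @counit_linear K A; have meA := @counit_monoid K A.
split=> //.
- apply: talg_hom_ext => [||||b].
  + exact: (linear_comp lcA lF).
  + exact: (linear_comp (tmap_linear lF lF) lc).
  + exact: (monoid_comp mcA mF).
  + exact: (monoid_comp (tmap_monoid lF lF mF mF) mc).
  rewrite talg_ext_in // cf /= -/(iota b) talg_comul_in.
  rewrite [RHS](tmap_comp l_iota l_iota lF lF).
  suff -> : talg_ext f \o iota = f by [].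
  by apply/funext => c; apply: talg_ext_in.
- apply: talg_hom_ext => [||||b] //=.
  + exact: (linear_comp leA lF).
  + exact: (monoid_comp meA mF).
  by rewrite talg_ext_in // ef -/(iota b) talg_counit_in.
Qed.

End TensorBialgebra.

(** * Convolution *)

Section Convolution.
Variables (K : comPzRingType) (B : bialgebra K).
Implicit Types A : kalgType K.

Definition conv A (a b : B -> A) (z : B) : A :=
  tlift (fun x y => a x * b y) (comul z).

Definition conv1 A (z : B) : A := (counit z : K) *: (1 : A).

Lemma mul_bilinear (U V : lmodType K) A (a : U -> A) (b : V -> A) :
  linear a -> linear b -> bilinear_map (fun x y => a x * b y).
Proof.
move=> la lb; split=> [v|u] c x y.
  by rewrite la mulrDl kscalerAl.
by rewrite lb mulrDr kscalerAr.
Qed.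

Lemma conv_linear A (a b : B -> A) : linear a -> linear b -> linear (conv a b).
Proof.
by move=> la lb; apply: (linear_comp (tlift_linear (mul_bilinear la lb)));
  apply: comul_linear.
Qed.

Lemma conv1_linear A : linear (@conv1 A).
Proof. by move=> c x y; rewrite /conv1 counit_linear scalerDl scalerA. Qed.

Lemma conv1l A (a : B -> A) : linear a -> conv (@conv1 A) a = a.
Proof.
move=> la; apply/funext => z; rewrite -[in RHS](counit_l z).
have be := scale_bilinear_l B (@counit_linear K B).
apply: (tens_linear_ext (tlift_linear (mul_bilinear (@conv1_linear A) la))
  (linear_comp la (tlift_linear be))) => x y /=.
rewrite !tlift_pure //; last exact: mul_bilinear (@conv1_linear A) la.
by have [_ _ ->] := linear_raw la; rewrite /conv1 -kscalerAl mul1r.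
Qed.

Lemma conv1r A (a : B -> A) : linear a -> conv a (@conv1 A) = a.
Proof.
move=> la; apply/funext => z; rewrite -[in RHS](counit_r z).
have be := scale_bilinear_r B (@counit_linear K B).
apply: (tens_linear_ext (tlift_linear (mul_bilinear la (@conv1_linear A)))
  (linear_comp la (tlift_linear be))) => x y /=.
rewrite !tlift_pure //; last exact: mul_bilinear la (@conv1_linear A).
by have [_ _ ->] := linear_raw la; rewrite /conv1 -kscalerAr mulr1.
Qed.

Lemma convA A (a b c : B -> A) : linear a -> linear b -> linear c ->
  conv a (conv b c) = conv (conv a b) c.
Proof.
move=> la lb lc; apply/funext => z.
have lB := @comul_linear K B; have lid : linear (@id B) := linear_id (U := B).
have lab := conv_linear la lb; have lbc := conv_linear lb lc.
have bab := mul_bilinear la lb; have bbc := mul_bilinear lb lc.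
have ba_bc := mul_bilinear la (tlift_linear bbc).
have lH := tlift_linear ba_bc.
pose H := tlift (fun x t => a x * tlift (fun y w => b y * c w) t).
transitivity (H (tmap id comul (comul z))).
  apply: (tens_linear_ext (tlift_linear (mul_bilinear la lbc))
    (linear_comp lH (tmap_linear lid lB))) => x y /=.
  rewrite tmap_pure // /H !tlift_pure //.
  exact: mul_bilinear la lbc.
rewrite -comulA.
have lasc := @tassoc_linear K B B B.
apply: (tens_linear_ext (linear_comp lH (linear_comp lasc (tmap_linear lB lid)))
  (tlift_linear (mul_bilinear lab lc))) => x w /=.
rewrite tmap_pure // tlift_pure; last exact: mul_bilinear lab lc.
have lw : linear (fun t : tens B B => t ⊗ w) := (@tpure_bilinear K _ B).1 w.
have lmw : linear (fun t : A => t * c w).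
  by move=> k s t; rewrite mulrDl kscalerAl.
apply: (tens_linear_ext (linear_comp lH (linear_comp lasc lw))
  (linear_comp lmw (tlift_linear bab))) => u v /=.
by rewrite tassoc_pure !tlift_pure // mulrA.
Qed.

Lemma conv_mor A A' (f : A -> A') (a b : B -> A) :
  linear f -> monoid_morphism f -> linear a -> linear b ->
  f \o conv a b = conv (f \o a) (f \o b).
Proof.
move=> lf mf la lb; apply/funext => z.
have bfab := mul_bilinear (linear_comp lf la) (linear_comp lf lb).
apply: (tens_linear_ext (linear_comp lf (tlift_linear (mul_bilinear la lb)))
  (tlift_linear bfab)) => x y /=.
rewrite (tlift_pure bfab) tlift_pure /= ?mf.2 //.
exact: mul_bilinear la lb.
Qed.

Lemma conv1_mor A A' (f : A -> A') :
  linear f -> monoid_morphism f -> f \o @conv1 A = @conv1 A'.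
Proof.
move=> lf mf; apply/funext => z /=; have [_ _ fZ] := linear_raw lf.
by rewrite /conv1 fZ mf.1.
Qed.

Lemma convC A (a b : B -> A) : cocommutative B -> linear a -> linear b ->
  (forall x y, a x * b y = b y * a x) -> conv a b = conv b a.
Proof.
move=> cB la lb ab; apply/funext => z; rewrite {1}/conv -(cB z).
have bab := mul_bilinear la lb; have bba := mul_bilinear lb la.
apply: (tens_linear_ext (linear_comp (tlift_linear bab) (@tswap_linear K B B))
  (tlift_linear bba)) => x y /=.
by rewrite tswap_pure !tlift_pure.
Qed.

(** The instance used is the one where b and c take values in the two commuting
copies of an algebra inside its tensor square. It takes the place of the
usual manipulation of fourfold comultiplications. *)
Lemma conv_interchange A (a b c d : B -> A) : cocommutative B ->
  linear a -> linear b -> linear c -> linear d ->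
  (forall x y, b x * c y = c y * b x) ->
  conv (conv a b) (conv c d) = conv (conv a c) (conv b d).
Proof.
move=> cB la lb lc ld bc.
have lbd := conv_linear lb ld; have lcd := conv_linear lc ld.
rewrite -convA // [conv b _]convA // (convC cB lb lc bc).
by rewrite -[conv (conv c b) _]convA // convA.
Qed.

Lemma conv_inv_unique A (a b c : B -> A) : linear a -> linear b -> linear c ->
  conv a b = @conv1 A -> conv b c = @conv1 A -> a = c.
Proof.
by move=> la lb lc ab bc; rewrite -(conv1r la) -bc convA // ab conv1l.
Qed.

End Convolution.

Arguments conv1 {K B} A z.

Lemma conv_precomp (K : comPzRingType) (B B' : bialgebra K) (A : kalgType K)
    (a b : B -> A) (c : B' -> B) :
  linear a -> linear b -> is_coalg_morphism c ->
  conv a b \o c = conv (a \o c) (b \o c).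
Proof.
move=> la lb [lc cc _]; apply/funext => z; rewrite /= /conv cc.
have bab := mul_bilinear la lb.
have babc := mul_bilinear (linear_comp la lc) (linear_comp lb lc).
apply: (tens_linear_ext (linear_comp (tlift_linear bab) (tmap_linear lc lc))
  (tlift_linear babc)) => x y /=.
by rewrite tmap_pure // (tlift_pure babc) tlift_pure.
Qed.

Lemma conv1_precomp (K : comPzRingType) (B B' : bialgebra K) (A : kalgType K)
    (c : B' -> B) :
  is_coalg_morphism c -> @conv1 K B A \o c = conv1 A.
Proof. by case=> _ _ ec; apply/funext => z; rewrite /conv1 /= ec. Qed.

Section ConvolutionCoalgebra.
Variables (K : comPzRingType) (A : kalgType K).

Definition tinl (x : A) : tens A A := x ⊗ (1 : A).
Definition tinr (x : A) : tens A A := (1 : A) ⊗ x.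

Lemma tinl_linear : linear tinl.
Proof. exact: (@tpure_bilinear K A A).1. Qed.

Lemma tinr_linear : linear tinr.
Proof. exact: (@tpure_bilinear K A A).2. Qed.

Lemma tinl_monoid : monoid_morphism tinl.
Proof. by split=> // x y; rewrite /tinl tpure_mul mulr1. Qed.

Lemma tinr_monoid : monoid_morphism tinr.
Proof. by split=> // x y; rewrite /tinr tpure_mul mulr1. Qed.

Lemma tinrlC x y : tinr x * tinl y = tinl y * tinr x.
Proof. by rewrite /tinl /tinr !tpure_mul !mulr1 !mul1r. Qed.

(** Seen this way, being compatible with comultiplications becomes an identity
in a convolution monoid. *)
Lemma tmap_conv (B : bialgebra K) (a b : B -> A) : linear a -> linear b ->
  tmap a b \o comul = conv (tinl \o a) (tinr \o b).
Proof.
move=> la lb; apply/funext => z.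
have bl := mul_bilinear (linear_comp tinl_linear la)
  (linear_comp tinr_linear lb).
apply: (tens_linear_ext (tmap_linear la lb) (tlift_linear bl)) => x y.
by rewrite tmap_pure // (tlift_pure bl) /= /tinl /tinr tpure_mul mul1r mulr1.
Qed.

End ConvolutionCoalgebra.

Section CoalgebraMorphisms.
Variables (K : comPzRingType) (B A : bialgebra K).
Hypothesis cB : cocommutative B.

(** The product of generalized elements is a generalized element: with inl and
inr the two embeddings of A into its tensor square, the comultiplication of A
carries a * b to (inl a * inr a) * (inl b * inr b), and cocommutativity of B
allows the middle factors to be exchanged. *)
Lemma coalg_conv (a b : B -> A) :
  is_coalg_morphism a -> is_coalg_morphism b -> is_coalg_morphism (conv a b).
Proof.
move=> [la ca ea] [lb cb eb]; have lab := conv_linear la lb.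
have lA := @comul_linear K A; have mA := @comul_monoid K A.
have leA := @counit_linear K A; have meA := @counit_monoid K A.
have li1 := @tinl_linear K A; have li2 := @tinr_linear K A.
split=> // z.
- have fcomp (f : B -> A) :
    linear f -> (forall x, comul (f x) = tmap f f (comul x)) ->
    comul \o f = conv (@tinl K A \o f) (@tinr K A \o f).
    by move=> lf cf; rewrite -tmap_conv //; apply/funext.
  suff : comul \o conv a b = tmap (conv a b) (conv a b) \o comul.
    by move/(congr1 (@^~ z)).
  rewrite tmap_conv // (conv_mor lA) // (fcomp a) // (fcomp b) //.
  rewrite conv_interchange //; try exact: linear_comp; last first.
    by move=> x y; apply: tinrlC.
  rewrite (conv_mor li1) //; last exact: tinl_monoid.
  by rewrite (conv_mor li2) //; apply: tinr_monoid.
- suff : counit \o conv a b = counit by move/(congr1 (@^~ z)).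
  rewrite (conv_mor leA) //.
  have -> : counit \o a = conv1 K^o.
    by apply/funext => x; rewrite /conv1 /= ea; apply/esym/mulr1.
  rewrite conv1l; last exact: linear_comp.
  by apply/funext => x; apply: eb.
Qed.

Lemma coalg_conv1 : is_coalg_morphism (@conv1 K B A).
Proof. exact: bialg_coalg (bialg_comp (from_triv A) (to_triv B)). Qed.

End CoalgebraMorphisms.

Lemma antipode_conv (K : comPzRingType) (H : bialgebra K) (S : H -> H) :
  is_antipode S -> conv S id = conv1 H /\ conv id S = conv1 H.
Proof. by case=> _ SH; split; apply/funext => x; case: (SH x). Qed.

(** Composing the comultiplication D of H with S gives a convolution inverse of
D = inl * inr. As inl and inr commute, (inl S) * (inr S) is another one, and
inverses are unique. *)
Lemma antipode_coalg (K : comPzRingType) (H : bialgebra K) (S : H -> H) :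
  cocommutative H -> is_antipode S -> is_coalg_morphism S.
Proof.
move=> cH aS; have [Sid idS] := antipode_conv aS; have lS := aS.1.
have lid : linear (@id H) := linear_id (U := H).
have lH := @comul_linear K H; have mH := @comul_monoid K H.
have leH := @counit_linear K H; have meH := @counit_monoid K H.
have li1 := @tinl_linear K H; have li2 := @tinr_linear K H.
have mi1 := @tinl_monoid K H; have mi2 := @tinr_monoid K H.
split=> // z.
- suff : comul \o S = tmap S S \o comul by move/(congr1 (@^~ z)).
  have DE : comul = conv (@tinl K H \o id) (@tinr K H \o id).
    by rewrite -tmap_conv //; apply/funext => x /=; rewrite tmap_id.
  rewrite tmap_conv //.
  apply: (@conv_inv_unique K H _ (comul \o S) comul).
  + exact: linear_comp.
  + by [].
  + by apply: conv_linear; apply: linear_comp.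
  + by rewrite -[X in conv _ X]/(comul \o id) -conv_mor // Sid conv1_mor.
  + rewrite DE conv_interchange //; try exact: linear_comp; last first.
      by move=> x y; apply: tinrlC.
    rewrite -!conv_mor // idS !conv1_mor //.
    by rewrite conv1l //; apply: conv1_linear.
- suff : counit \o S = counit by move/(congr1 (@^~ z)).
  have eE : @counit K H = conv1 K^o.
    by apply/funext => x; apply/esym/mulr1.
  rewrite -[LHS]conv1r; last exact: linear_comp.
  rewrite -eE -[X in conv _ X]/(counit \o id) -conv_mor // Sid.
  by rewrite conv1_mor // -eE.
Qed.

(** * Universal properties with respect to coalgebra morphisms *)

Section CoalgebraElements.
Variable K : comPzRingType.
Implicit Types W X Y Z P M N : coc_bialgebra K.

Definition tensor_coc_bialgebra Z : coc_bialgebra K :=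
  CocBialgebra (tensor_cocommutative (@coc_comm K Z)).

Definition coalg_ext Z X (a : Z -> X) (ca : is_coalg_morphism a) :
    bialg_hom (tensor_coc_bialgebra Z) X :=
  BialgHom (talg_ext_bialg ca).

Lemma coalg_ext_in Z X (a : Z -> X) z :
  is_coalg_morphism a -> talg_ext a (talg_in z) = a z.
Proof. by case=> la _ _; apply: talg_ext_in. Qed.

Lemma bialg_hom_app (A B : bialgebra K) (f g : bialg_hom A B) :
  f = g -> forall x, f x = g x.
Proof. by move=> ->. Qed.

Lemma coalg_ext_eq Z X (f g : bialg_hom (tensor_coc_bialgebra Z) X) :
  (forall z : Z, f (talg_in z) = g (talg_in z)) -> f = g.
Proof.
case: f g => f [lf mf cf ef] [g [lg mg cg eg]] /= fg.
by apply: bialg_hom_eq; apply: talg_hom_ext.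
Qed.

Lemma mono_coalg M X (m : bialg_hom M X) Z (a b : Z -> M) :
  @is_mono (BiAlgCoc K) M X m -> is_coalg_morphism a -> is_coalg_morphism b ->
  m \o a = m \o b -> a = b.
Proof.
move=> mono_m ca cb mab; apply/funext => z.
rewrite -(coalg_ext_in _ ca) -(coalg_ext_in _ cb).
suff E : coalg_ext ca = coalg_ext cb.
  exact: (bialg_hom_app E (talg_in z)).
apply: mono_m; apply: coalg_ext_eq => y /=.
by rewrite !coalg_ext_in //; apply: (congr1 (@^~ y) mab).
Qed.

Lemma pullback_coalg W X Y (g : bialg_hom W Y) (f : bialg_hom X Y)
    P (p : bialg_hom P W) (q : bialg_hom P X) Z (u : Z -> W) (v : Z -> X) :
  @is_pullback (BiAlgCoc K) W X Y g f P p q ->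
  is_coalg_morphism u -> is_coalg_morphism v -> g \o u = f \o v ->
  exists h : Z -> P, [/\ is_coalg_morphism h, p \o h = u & q \o h = v].
Proof.
case=> _ pb cu cv guv.
have [|h [[ph qh] _]] := pb _ (coalg_ext cu) (coalg_ext cv).
  apply: coalg_ext_eq => z /=; rewrite !coalg_ext_in //.
  exact: (congr1 (@^~ z) guv).
exists ((h : bialg_hom _ _) \o @talg_in K Z); split.
- exact: coalg_comp (bialg_coalg h) (talg_in_coalg Z).
- apply/funext => z; rewrite -(coalg_ext_in _ cu).
  exact: (bialg_hom_app ph (talg_in z)).
- apply/funext => z; rewrite -(coalg_ext_in _ cv).
  exact: (bialg_hom_app qh (talg_in z)).
Qed.

Lemma pullback_coalg_unique W X Y (g : bialg_hom W Y) (f : bialg_hom X Y)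
    P (p : bialg_hom P W) (q : bialg_hom P X) Z (h h' : Z -> P) :
  @is_pullback (BiAlgCoc K) W X Y g f P p q ->
  is_coalg_morphism h -> is_coalg_morphism h' ->
  p \o h = p \o h' -> q \o h = q \o h' -> h = h'.
Proof.
case=> gpfq pb ch ch' ph qh; apply/funext => z.
rewrite -(coalg_ext_in _ ch) -(coalg_ext_in _ ch').
have [|k [_ uk]] :=
    pb _ (bialg_comp p (coalg_ext ch)) (bialg_comp q (coalg_ext ch)).
  apply: bialg_hom_eq => t.
  exact: (bialg_hom_app gpfq (coalg_ext ch t)).
suff E : coalg_ext ch = coalg_ext ch'.
  exact: (bialg_hom_app E (talg_in z)).
rewrite -[LHS]uk; last by [].
apply: uk; split; apply: coalg_ext_eq => y /=; rewrite !coalg_ext_in //.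
  exact: (congr1 (@^~ y) (esym ph)).
exact: (congr1 (@^~ y) (esym qh)).
Qed.

Lemma kernel_coalg X Y (f : bialg_hom X Y) N (k : bialg_hom N X)
    Z (h : Z -> X) :
  @is_kernel (BiAlgCoc K) X Y f N k ->
  is_coalg_morphism h -> f \o h = conv1 Y ->
  exists2 n : Z -> N, is_coalg_morphism n & k \o n = h.
Proof.
case=> _ ker ch fh.
have [|n [kn _]] := ker _ (coalg_ext ch).
  apply: coalg_ext_eq => z /=; rewrite coalg_ext_in //.
  rewrite (talg_counit_in z).
  exact: (congr1 (@^~ z) fh).
exists ((n : bialg_hom _ _) \o @talg_in K Z).
  exact: coalg_comp (bialg_coalg n) (talg_in_coalg Z).
apply/funext => z; rewrite -(coalg_ext_in _ ch).
exact: (bialg_hom_app kn (talg_in z)).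
Qed.

Lemma coalg_inverse_iso M X (m : bialg_hom M X) (r : X -> M) :
  is_coalg_morphism r -> cancel m r -> cancel r m ->
  @is_iso (BiAlgCoc K) M X m.
Proof.
case: m => m [lm mm cm em] /= [lr cr er] mK rK.
have rP : is_bialg_morphism r.
  split=> //; split=> [|x y]; first by rewrite -mm.1 mK.
  by rewrite -{1}[x]rK -{1}[y]rK -mm.2 mK.
by exists (BialgHom rP); split; apply: bialg_hom_eq.
Qed.

End CoalgebraElements.

(** The decomposition of pairs carried out on the generic element, the identity
of P; the antipode enters through the image of P in H. *)
Lemma pullback_strong (K : comPzRingType) (H : coc_bialgebra K) (S : H -> H)
    (W X P N : coc_bialgebra K)
    (f : bialg_hom X H) (s : bialg_hom H X) (g : bialg_hom W H)
    (p : bialg_hom P W) (q : bialg_hom P X) (t : bialg_hom W P)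
    (k : bialg_hom N P) :
  is_antipode S -> f \o s = id -> p \o t = id -> q \o t = s \o g ->
  @is_pullback (BiAlgCoc K) W X H g f P p q ->
  @is_kernel (BiAlgCoc K) P W p N k ->
  @jointly_extremally_epic (BiAlgCoc K) N P W k t.
Proof.
move=> aS fs pt qt pb ker.
suff main (M : coc_bialgebra K) (m : bialg_hom M P)
    (k' : bialg_hom N M) (t' : bialg_hom W M) :
    @is_mono (BiAlgCoc K) M P m -> m \o k' = k -> m \o t' = t ->
    @is_iso (BiAlgCoc K) M P m.
  move=> M m mono_m [k' mk] [t' mt]; apply: (main M m k' t') => //.
    by apply/funext => x; apply: (bialg_hom_app mk x).
  by apply/funext => x; apply: (bialg_hom_app mt x).
move=> mono_m mk mt.
have coc (B : coc_bialgebra K) : cocommutative B := @coc_comm K B.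
have mor (B C : coc_bialgebra K) (h : bialg_hom B C) : is_coalg_morphism h :=
  bialg_coalg h.
have lin (B C : bialgebra K) (h : B -> C) : is_coalg_morphism h -> linear h.
  by case.
have hom_linear (B C : coc_bialgebra K) (h : bialg_hom B C) : linear h.
  by case: h => h [].
have hom_monoid (B C : coc_bialgebra K) (h : bialg_hom B C) : monoid_morphism h.
  by case: h => h [].
have [Sid idS] := antipode_conv aS.
have cS : @is_coalg_morphism K H H S := antipode_coalg (coc H) aS.
have lS := lin _ _ _ cS; have lid : linear (@id H) := linear_id (U := H).
have gpfq : g \o p = f \o q by apply/funext => x; apply: (bialg_hom_app pb.1 x).
have cgp : is_coalg_morphism (g \o p) by apply: coalg_comp; apply: mor.
have csgp : is_coalg_morphism (s \o (g \o p)) by apply: coalg_comp.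
have csSgp : is_coalg_morphism (s \o (S \o (g \o p))).
  by apply: coalg_comp => //; apply: coalg_comp.
(* On elements (w, x) of P, this is x * s (g w)^-1. *)
pose c : P -> X := conv q (s \o (S \o (g \o p))).
have cc : is_coalg_morphism c by apply: coalg_conv.
have lq := hom_linear _ _ q; have lsgp := lin _ _ _ csgp.
have lsSgp := lin _ _ _ csSgp.
have fc : f \o c = conv1 H.
  rewrite conv_mor // -gpfq -[f \o (s \o _)]/((f \o s) \o (S \o (g \o p))) fs.
  rewrite -[X in conv X _]/(id \o (g \o p)) -[id \o (S \o _)]/(S \o (g \o p)).
  by rewrite -conv_precomp // idS conv1_precomp.
have g1 : g \o conv1 W = @conv1 K P H by apply: conv1_mor.
(* The kernel component (1, x * s (g w)^-1), first as an element of P. *)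
have [n0 [cn0 pn0 qn0]] : exists h : P -> P,
    [/\ is_coalg_morphism h, p \o h = conv1 W & q \o h = c].
  by apply: (pullback_coalg pb _ cc); [apply: coalg_conv1|rewrite fc].
have [n cn kn] := kernel_coalg ker cn0 pn0.
have ckn : is_coalg_morphism (k' \o n) by apply: coalg_comp.
have ctp : is_coalg_morphism (t' \o p) by apply: coalg_comp.
have ctp' : is_coalg_morphism (t \o p) by apply: coalg_comp.
pose r : P -> M := conv (k' \o n) (t' \o p).
have cr : is_coalg_morphism r by apply: coalg_conv.
(* The decomposition of (w, x), checked on both projections of the pullback. *)
have mr : m \o r = id.
  rewrite conv_mor //; try exact: lin.
  rewrite -[m \o (k' \o n)]/((m \o k') \o n) mk kn.
  rewrite -[m \o (t' \o p)]/((m \o t') \o p) mt.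
  have ln0 := lin _ _ _ cn0; have ltp := lin _ _ _ ctp'.
  apply: (pullback_coalg_unique pb).
  - exact: coalg_conv.
  - exact: mor (bialg_id P).
  - rewrite conv_mor // pn0 -[p \o (t \o p)]/((p \o t) \o p) pt.
    by rewrite conv1l //; apply: hom_linear.
  - rewrite conv_mor // qn0 -[q \o (t \o p)]/((q \o t) \o p) qt.
    rewrite -[(s \o g) \o p]/(s \o (g \o p)) -convA //.
    rewrite -[X in conv _ X]conv_mor //; try exact: lin; last first.
      exact: linear_comp lS (lin _ _ _ cgp).
    rewrite -[X in conv (S \o _) X]/(id \o (g \o p)) -conv_precomp // Sid.
    by rewrite conv1_precomp // conv1_mor // conv1r.
have rm : r \o m = id.
  apply: (mono_coalg mono_m); first by apply: coalg_comp.
    exact: mor (bialg_id M).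
  by rewrite -[LHS]/((m \o r) \o m) mr.
by apply: (coalg_inverse_iso cr) => x;
  [apply: (congr1 (@^~ x) rm)|apply: (congr1 (@^~ x) mr)].
Qed.

Theorem corollary2p5 (K : comPzRingType) (H : coc_bialgebra K) (hopfH : is_hopf H) :
  protomodular_object (H : BiAlgCoc K).
Proof.
case: hopfH => S aS [X0 X k0 f s ker0 fs] W g [N P k p t ker pt] [q [pb qt]].
rewrite /strong /=; apply: (pullback_strong aS _ _ _ pb ker).
- by apply/funext => x; apply: (bialg_hom_app fs x).
- by apply/funext => x; apply: (bialg_hom_app pt x).
- by apply/funext => x; apply: (bialg_hom_app qt x).
Qed.
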